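(* Let $(\bar Y,\bar u,\bar v,\bar z,\bar l)\in\Lambda$. Then the outer approximation (OA) cut at this point associated with the constraints $$\epsilon_H\|u+v+z\|_2+(u+v+z)^{\mathsf T}\hat{\mathbf d}^h\le l_h,\qquad h\in[H],$$ is $$\epsilon_H(\bar u+\bar v+\bar z)^{\mathsf T}(u+v+z)+\big[(u+v+z)^{\mathsf T}\hat{\mathbf d}^h-l_h\big]\,\|\bar u+\bar v+\bar z\|_2\le0,\qquad\forall h\in[H].$$ That is, for each $h\in[H]$ this linear inequality in $(u,v,z,l_h)$ is satisfied by every $(u,v,z,l_h)$ that satisfies the corresponding constraint, and, when $\bar u+\bar v+\bar z\ne0$, it is equivalent to the first-order linearization inequality of that constraint at $(\bar u,\bar v,\bar z,\bar l_h)$.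
   Context: Notation: $I,J,T,H$ are positive integers, $[n]=\{1,\dots,n\}$; $\epsilon_H\ge0$ is a real number; $\hat{\mathbf d}^1,\dots,\hat{\mathbf d}^H\in\mathbb R^I$ are given samples; $c_{ji}$, $\mu(1),\dots,\mu(T),\mu(\infty)$ are given real numbers and $\alpha\in[0,1]$. The set $\Lambda$ consists of all $(Y,u,v,z,l)$ with $Y=(Y_{jit})$, $Y_{jit}\in[0,1]$ for $j\in[J],i\in[I],t\in[T]$, $u,v,z\in\mathbb R^I$, $l\in\mathbb R^H$, satisfying for all $i\in[I]$: $\alpha\le\sum_{t\in[T]}\sum_{j\in[J]}Y_{jit}\le1$, $u_i=\sum_{t\in[T]}\sum_{j\in[J]}c_{ji}Y_{jit}$, $v_i=\sum_{t\in[T]}\sum_{j\in[J]}\mu(t)Y_{jit}$, $z_i=\mu(\infty)\big(1-\sum_{t\in[T]}\sum_{j\in[J]}Y_{jit}\big)$. (Points of $\Lambda$ need not satisfy the constraints being approximated.) OA cut: for a convex constraint $\phi(x)\le0$ and a point $\bar x$ at which $\phi$ is differentiable, the OA cut at $\bar x$ is the linear inequality $\phi(\bar x)+\nabla\phi(\bar x)^{\mathsf T}(x-\bar x)\le0$ (up to multiplication by a positive constant). Here the constraint is $\phi_h(u,v,z,l_h)\le0$ with $\phi_h(u,v,z,l_h)=\epsilon_H\|u+v+z\|_2+(u+v+z)^{\mathsf T}\hat{\mathbf d}^h-l_h$. If $\bar u+\bar v+\bar z=0$ the cut is vacuous. *)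

(* Defs.v *)
(* MathComp-Analysis, over an arbitrary R : realType; R^n is 'cV[R]_n. *)
From mathcomp Require Import all_boot all_order all_algebra.
From mathcomp Require Import boolp classical_sets reals topology normedtype.
From mathcomp Require Import derive convex.

Set Implicit Arguments.
Unset Strict Implicit.
Unset Printing Implicit Defensive.

Import Order.TTheory GRing.Theory Num.Theory.
Import numFieldNormedType.Exports.

Local Open Scope classical_set_scope.
Local Open Scope ring_scope.

Definition dot (R : realType) (n : nat) (x y : 'cV[R]_n) : R :=
  \sum_(i < n) x i 0 * y i 0.

(* The library norm `|x| on 'cV[R]_n is the max norm, hence this definition. *)
Definition norm2 (R : realType) (n : nat) (x : 'cV[R]_n) : R :=
  Num.sqrt (\sum_(i < n) x i 0 ^+ 2).

(* The period t : 'I_T stands for the (t+1)-th element of [T] = {1, ..., T}, so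
   [mu t] is mu(t+1); [muinf] is mu(oo). *)
Definition Lambda (R : realType) (I J T H : nat) (c : 'M[R]_(J, I))
    (mu : 'I_T -> R) (muinf alpha : R) :
    set (('I_J -> 'I_I -> 'I_T -> R) *
         'cV[R]_I * 'cV[R]_I * 'cV[R]_I * 'cV[R]_H) :=
  fun p => let: (Y, u, v, z, _) := p in
    (forall j i t, 0 <= Y j i t <= 1) /\
    forall i : 'I_I,
      [/\ alpha <= \sum_(t < T) \sum_(j < J) Y j i t <= 1,
          u i 0 = \sum_(t < T) \sum_(j < J) c j i * Y j i t,
          v i 0 = \sum_(t < T) \sum_(j < J) mu t * Y j i t &
          z i 0 = muinf * (1 - \sum_(t < T) \sum_(j < J) Y j i t)].

Definition phi (R : realType) (I : nat) (eps : R) (d : 'cV[R]_I)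
    (x : 'cV[R]_I * 'cV[R]_I * 'cV[R]_I * R^o) : R^o :=
  let: (u, v, z, lh) := x in
  eps * norm2 (u + v + z) + dot (u + v + z) d - lh.

(* The gradient term (grad f(xbar))^T (x - xbar) is the Frechet differential of
   f at xbar applied to x - xbar. *)
Definition linearization (R : realType) (V : normedModType R) (f : V -> R^o)
    (xbar x : V) : R :=
  f xbar + 'd f xbar (x - xbar).

(* g x <= 0 is the outer approximation cut at xbar of the convex constraint
   f x <= 0; the cut is only determined up to a positive factor. *)
Definition is_oa_cut (R : realType) (V : normedModType R) (f : V -> R^o)
    (xbar : V) (g : V -> R) : Prop :=
  [/\ convex_function [set: V] f,
      differentiable f xbar &
      exists2 k : R, 0 < k & forall x, g x = k * linearization f xbar x].

(* Main.v *)
Require Import Defs.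
From HB Require Import structures.
From mathcomp Require Import all_boot all_order all_algebra.
From mathcomp Require Import boolp classical_sets functions reals topology.
From mathcomp Require Import normedtype derive convex realfun.
From mathcomp Require Import interval_inference.
From mathcomp Require Import ring lra.

Set Implicit Arguments.
Unset Strict Implicit.
Unset Printing Implicit Defensive.

Import Order.TTheory GRing.Theory Num.Theory.
Import numFieldNormedType.Exports.

Local Open Scope classical_set_scope.
Local Open Scope ring_scope.


(** The constraint function phi depends on (u, v, z) only through the linear map
    (u, v, z) |-> s = u + v + z, and away from s = 0 the Euclidean norm is
    differentiable with gradient s / |s|.  Since the norm and the inner product
    are homogeneous, the linearization of phi at a point with sum sbar <> 0
    collapses: the terms eps |sbar| and <sbar, d> of phi cancel against the
    values of the differential at sbar, leaving
      eps <sbar, s> / |sbar| + <s, d> - l,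
    and multiplication by |sbar| > 0 gives the announced cut
    ([cut_linearization]).

    Validity of the cut is the inequality of Cauchy and Schwarz
    ([Cauchy_Schwarz]): <sbar, s> <= |sbar| |s| bounds the cut above by
    |sbar| times phi, so the cut is nonpositive wherever phi is.  This argument
    also covers sbar = 0, where every term of the cut vanishes.  The same
    inequality gives the triangle inequality of the norm, hence the convexity of
    phi ([convex_phi]).

    The differential of the norm comes from the chain rule, writing it as the
    square root of <s, s> and differentiating the latter coordinatewise
    ([is_diff_norm2]). *)

(** * The inner product and the Euclidean norm *)

Section Euclidean.
Variables (R : realType) (n : nat).
Implicit Types (x y z : 'cV[R]_n) (a : R).

Lemma dotC x y : dot x y = dot y x.
Proof. by apply: eq_bigr => i _; rewrite mulrC. Qed.

Lemma dotDl x y z : dot (x + y) z = dot x z + dot y z.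
Proof. by rewrite -big_split; apply: eq_bigr => i _; rewrite mxE mulrDl. Qed.

Lemma dotZl a x y : dot (a *: x) y = a * dot x y.
Proof. by rewrite mulr_sumr; apply: eq_bigr => i _; rewrite mxE mulrA. Qed.

Lemma dotDr x y z : dot x (y + z) = dot x y + dot x z.
Proof. by rewrite dotC dotDl !(dotC x). Qed.

Lemma dotZr a x y : dot x (a *: y) = a * dot x y.
Proof. by rewrite dotC dotZl (dotC x). Qed.

Lemma dot0l y : dot 0 y = 0.
Proof. by rewrite -(scale0r 0) dotZl mul0r. Qed.

Lemma dot_ge0 x : 0 <= dot x x.
Proof. by apply: sumr_ge0 => i _; rewrite -expr2 sqr_ge0. Qed.

Lemma norm2E x : norm2 x = Num.sqrt (dot x x).
Proof. by []. Qed.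

Lemma norm2_ge0 x : 0 <= norm2 x.
Proof. exact: sqrtr_ge0. Qed.

Lemma sqr_norm2 x : norm2 x ^+ 2 = dot x x.
Proof. by rewrite norm2E sqr_sqrtr ?dot_ge0. Qed.

Lemma norm2_eq0 x : (norm2 x == 0) = (x == 0).
Proof.
apply/idP/eqP => [|->]; last by rewrite norm2E dot0l sqrtr0.
rewrite -sqrf_eq0 sqr_norm2 psumr_eq0 => [|i _]; last by rewrite -expr2 sqr_ge0.
move=> /allP x0; apply/matrixP => i j; rewrite ord1 mxE.
by have := x0 i (mem_index_enum i); rewrite -expr2 sqrf_eq0 => /eqP.
Qed.

Lemma norm2_gt0 x : (0 < norm2 x) = (x != 0).
Proof. by rewrite lt0r norm2_ge0 andbT norm2_eq0. Qed.

Lemma norm2_0 : norm2 (0 : 'cV[R]_n) = 0.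
Proof. by apply/eqP; rewrite norm2_eq0. Qed.

Lemma norm2Z a x : 0 <= a -> norm2 (a *: x) = a * norm2 x.
Proof.
move=> a0; rewrite norm2E dotZl dotZr mulrA -expr2 sqrtrM ?sqr_ge0//.
by rewrite sqrtr_sqr ger0_norm.
Qed.

(** Expanding <w, w> >= 0 for w = |y| x - |x| y gives
    2 |x| |y| (|x| |y| - <x, y>) >= 0. *)
Lemma Cauchy_Schwarz x y : dot x y <= norm2 x * norm2 y.
Proof.
have [->|x0] := eqVneq x 0; first by rewrite dot0l norm2_0 mul0r.
have [->|y0] := eqVneq y 0; first by rewrite dotC dot0l norm2_0 mulr0.
have := dot_ge0 (norm2 y *: x + - norm2 x *: y).
rewrite !(dotDl, dotDr, dotZl, dotZr) -!sqr_norm2 (dotC y x).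
have xy_gt0 : 0 < norm2 x * norm2 y by rewrite mulr_gt0 // norm2_gt0.
move=> sq_ge0; rewrite -subr_ge0 -(pmulr_rge0 _ xy_gt0); lra.
Qed.

(** Split |x + y|^2 = <x, x + y> + <y, x + y>, apply the inequality of Cauchy
    and Schwarz to both terms, and cancel |x + y|. *)
Lemma ler_norm2D x y : norm2 (x + y) <= norm2 x + norm2 y.
Proof.
have [->|xy0] := eqVneq (x + y) 0; first by rewrite norm2_0 addr_ge0 ?norm2_ge0.
rewrite -norm2_gt0 in xy0; rewrite -(ler_pM2r xy0) -expr2 sqr_norm2 {1}dotDl mulrDl.
by rewrite lerD ?Cauchy_Schwarz.
Qed.

End Euclidean.

(** * Differentials *)

Lemma is_diff_linear (R : numFieldType) (V W : normedModType R) (f : V -> W) x :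
  linear f -> continuous f -> is_diff x f f.
Proof.
move=> flin fcont.
pose fM := GRing.isLinear.Build _ _ _ _ f flin.
pose fL : {linear V -> W} := HB.pack f fM.
rewrite -[f]/(fL : V -> W); apply: DiffDef; first exact: linear_differentiable.
by rewrite diff_lin.
Qed.

Lemma is_diff_sum (R : numFieldType) (V W : normedModType R) (n : nat)
    (f df : 'I_n -> V -> W) x :
  (forall i, is_diff x (f i) (df i)) ->
  is_diff x (fun y => \sum_i f i y) (fun y => \sum_i df i y).
Proof.
move=> fdf; rewrite -!fct_sumE.
elim/big_ind2 : _ => [|g dg g' dg' ? ?|i _]; last exact: fdf.
- exact: is_diff_cst.
- exact: is_diffD.
Qed.

Section EuclideanDiff.
Variables (R : realType) (n : nat).
Implicit Types (s w d : 'cV[R]_n).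

Lemma is_diff_coord s (i : 'I_n) :
  is_diff s (fun w => w i 0 : R^o) (fun w => w i 0 : R^o).
Proof.
by apply: is_diff_linear => [a x y|]; [rewrite !mxE | exact: coord_continuous].
Qed.

Lemma is_diff_dotl d s :
  is_diff s (fun w => dot w d : R^o) (fun w => dot w d : R^o).
Proof.
apply: is_diff_sum => i.
have := is_diffZ (d i 0) (is_diff_coord s i).
by congr (is_diff_def _ _ _); apply/funext => w; rewrite /= mulrC.
Qed.

Lemma is_diff_sqnorm2 s :
  is_diff s (fun w => dot w w : R^o) (fun w => 2 * dot s w : R^o).
Proof.
have -> : (fun w => 2 * dot s w : R^o) =
    fun w => \sum_i (s i 0 * w i 0 + s i 0 * w i 0).
  by apply/funext => w; rewrite big_split /= -mulr2n mulr_natl.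
apply: is_diff_sum => i.
exact: is_diffM (is_diff_coord s i) (is_diff_coord s i).
Qed.

(** The derivative of the square root, restated as a differential so that it
    composes with maps defined on a space of vectors. *)
Lemma is_diff_sqrt (r : R) : 0 < r ->
  is_diff (r : R^o) (Num.sqrt : R^o -> R^o)
    (fun w : R^o => w / (2 * Num.sqrt r) : R^o).
Proof.
move=> r0; have dsqrt := is_derive1_sqrt r0.
apply: DiffDef; first exact/derivable1_diffP/ex_derive.
rewrite diff1E; last exact/derivable1_diffP/ex_derive.
by apply/funext => w; rewrite derive1E derive_val.
Qed.

Lemma is_diff_norm2 s : s != 0 ->
  is_diff s (fun w => norm2 w : R^o) (fun w => dot s w / norm2 s : R^o).
Proof.
move=> s0; have s_gt0 : 0 < dot s s by rewrite -sqr_norm2 exprn_gt0 ?norm2_gt0.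
apply: (is_diff_eq (is_diff_comp (is_diff_sqnorm2 s) (is_diff_sqrt s_gt0))).
apply/funext => w /=; rewrite -norm2E.
by rewrite invfM mulrACA divff ?mul1r.
Qed.

End EuclideanDiff.

(** * The approximated constraint function *)

Section Phi.
Variables (R : realType) (I : nat) (eps : R) (d : 'cV[R]_I).
Local Notation V := ('cV[R]_I * 'cV[R]_I * 'cV[R]_I * R^o)%type.
Implicit Types x y : V.

Definition total x : 'cV[R]_I := x.1.1.1 + x.1.1.2 + x.1.2.

Lemma phiE x :
  phi eps d x = eps * norm2 (total x) + dot (total x) d - x.2.
Proof. by case: x => [[[u v] z] l]. Qed.

Lemma total_linear : linear total.
Proof.
by move=> a x y; rewrite /total /= !scalerDr [RHS]addrACA (addrACA (a *: _)).
Qed.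

Lemma totalZ a x : total (a *: x) = a *: total x.
Proof. by rewrite /total /= !scalerDr. Qed.

Lemma total_continuous : continuous total.
Proof.
move=> x; apply: cvgD; first apply: cvgD.
- apply: (cvg_comp fst (fst \o fst)); first exact: cvg_fst.
  by apply: (cvg_comp fst fst); exact: cvg_fst.
- apply: (cvg_comp fst (snd \o fst)); first exact: cvg_fst.
  by apply: (cvg_comp fst snd); [exact: cvg_fst|exact: cvg_snd].
- by apply: (cvg_comp fst snd); [exact: cvg_fst|exact: cvg_snd].
Qed.

Lemma is_diff_phi x : total x != 0 ->
  is_diff x (phi eps d)
    (fun w => eps * (dot (total x) (total w) / norm2 (total x))
              + dot (total w) d - w.2).
Proof.
move=> s0.
have dtot := is_diff_linear x total_linear total_continuous.
have dsnd : is_diff x (snd : V -> R^o) snd.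
  by apply: is_diff_linear => // y; exact: cvg_snd.
have dnorm := is_diff_comp dtot (is_diff_norm2 s0).
have ddot := is_diff_comp dtot (is_diff_dotl d (total x)).
rewrite (_ : phi eps d = fun y => eps * norm2 (total y) + dot (total y) d - y.2).
  exact: is_diffB (is_diffD (is_diffZ eps dnorm) ddot) dsnd.
exact/funext/phiE.
Qed.

(** The norm is sublinear and the other terms of phi are linear. *)
Lemma convex_phi : 0 <= eps -> convex_function [set: V] (phi eps d).
Proof.
move=> eps0 t x y _ _.
have t0 : 0 <= t%:num by [].
have t1 : 0 <= 1 - t%:num by rewrite subr_ge0.
rewrite convRE.
rewrite -[conv t x y]/(t%:num *: (x : V) + (1 - t%:num) *: (y : V)).
rewrite !phiE total_linear totalZ (dotDl (_ *: _)) !dotZl /=.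
have nD : norm2 (t%:num *: total x + (1 - t%:num) *: total y) <=
    t%:num * norm2 (total x) + (1 - t%:num) * norm2 (total y).
  by rewrite -!norm2Z // ler_norm2D.
have := ler_wpM2l eps0 nD.
rewrite /unstable.onem /GRing.scale /=.
lra.
Qed.

(** The differential of phi maps w to
    eps <s, total w> / |s| + <total w, d> - w.2 with s = total x; at w = x it
    equals phi x, because <s, s> = |s|^2.  Hence the linearization has no
    constant term, and the factor |s| clears the only denominator. *)
Lemma cut_linearization x y : total x != 0 ->
  eps * dot (total x) (total y) + (dot (total y) d - y.2) * norm2 (total x) =
  norm2 (total x) * linearization (phi eps d) x y.
Proof.
move=> s0; have [_ dphi] := is_diff_phi s0.
rewrite /linearization dphi phiE.
have -> : total (y - x) = total y - total x.
  by rewrite -scaleN1r addrC total_linear scaleN1r addrC.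
rewrite /=; move: (total x) (total y) s0 => s w s0.
rewrite -(scaleN1r s) dotDl dotDr dotZl dotZr -sqr_norm2.
field.
by rewrite norm2_eq0.
Qed.

End Phi.

Theorem proposition4p1 (R : realType) (I J T H : nat)
    (hI : (0 < I)%N) (hJ : (0 < J)%N) (hT : (0 < T)%N) (hH : (0 < H)%N)
    (epsH : R) (heps : 0 <= epsH) (d : 'I_H -> 'cV[R]_I)
    (c : 'M[R]_(J, I)) (mu : 'I_T -> R) (muinf alpha : R)
    (halpha : 0 <= alpha <= 1)
    (Ybar : 'I_J -> 'I_I -> 'I_T -> R) (ubar vbar zbar : 'cV[R]_I)
    (lbar : 'cV[R]_H)
    (hbar : Lambda c mu muinf alpha (Ybar, ubar, vbar, zbar, lbar)) :
  let sbar := ubar + vbar + zbar in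
  forall h : 'I_H,
  let xbar := (ubar, vbar, zbar, lbar h 0 : R^o) in
  let cut (x : 'cV[R]_I * 'cV[R]_I * 'cV[R]_I * R^o) : R :=
    let: (u, v, z, lh) := x in
    epsH * dot sbar (u + v + z)
      + (dot (u + v + z) (d h) - lh) * norm2 sbar in
  [/\ forall (u v z : 'cV[R]_I) (lh : R),
        epsH * norm2 (u + v + z) + dot (u + v + z) (d h) <= lh ->
        cut (u, v, z, lh) <= 0,
      sbar != 0 ->
        is_oa_cut (phi epsH (d h)) xbar cut /\
        forall x, cut x <= 0 <-> linearization (phi epsH (d h)) xbar x <= 0 &
      sbar = 0 -> forall x, cut x <= 0].
Proof.
move=> sbar h xbar cut.
have cutE x : cut x = epsH * dot sbar (total x)
    + (dot (total x) (d h) - x.2) * norm2 sbar by case: x => [[[u v] z] l].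
split.
- move=> u v z lh le_lh; rewrite /cut.
  set s := u + v + z.
  have CS := ler_wpM2l heps (Cauchy_Schwarz sbar s).
  have := ler_wpM2r (norm2_ge0 sbar) le_lh; rewrite -/s.
  lra.
- move=> s0; have s_gt0 : 0 < norm2 sbar by rewrite norm2_gt0.
  have cut_lin x : cut x = norm2 sbar * linearization (phi epsH (d h)) xbar x.
    by rewrite cutE -(@cut_linearization _ _ _ _ xbar).
  split; last by move=> x; rewrite cut_lin pmulr_rle0.
  split; [exact: convex_phi| |by exists (norm2 sbar)].
  by have [] := is_diff_phi epsH (d h) (x := xbar) s0.
- by move=> s0 x; rewrite cutE s0 dot0l norm2_0 !mulr0 addr0.
Qed.
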